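(* Let $G$ be a connected graph of order $n$ having $t$ twin equivalence classes. If $G$ has no singleton twin equivalence class, then $$\operatorname{dim}_A(G)=\operatorname{dim}(G)=n-t.$$
   Context: All graphs are finite, simple, undirected. The twin equivalence relation on $V(G)$ is: $x\,\mathcal R\,y$ iff $N_G[x]=N_G[y]$ or $N_G(x)=N_G(y)$ (closed, resp. open neighbourhoods); its classes are the twin equivalence classes. For connected $G$ with shortest-path distance $d$, a metric generator is a vertex set $S$ such that every two distinct vertices $x,y$ satisfy $d(s,x)\ne d(s,y)$ for some $s\in S$; $\operatorname{dim}(G)$ is the minimum size of a metric generator. An adjacency generator is a set $S$ such that for every two distinct $x,y\in V(G)\setminus S$ there exists $s\in S$ with $|N_G(s)\cap\{x,y\}|=1$; $\operatorname{dim}_A(G)$ is the minimum size of an adjacency generator. *)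

(* Defs.v *)
From mathcomp Require Import all_boot.

Set Implicit Arguments.
Unset Strict Implicit.
Unset Printing Implicit Defensive.

Section Graphs.

Variables (V : finType) (e : rel V).

Definition connected_graph : Prop := forall x y : V, connect e x y.

Definition open_nbhd (x : V) : {set V} := [set y | e x y].

Definition closed_nbhd (x : V) : {set V} := x |: open_nbhd x.

Definition twin : rel V := [rel x y |
  (closed_nbhd x == closed_nbhd y) || (open_nbhd x == open_nbhd y)].

Definition twin_classes : {set {set V}} := equivalence_partition twin [set: V].

Definition has_walk (k : nat) (x y : V) : bool :=
  [exists p : k.-tuple V, path e x p && (last x p == y)].

(* Least length of a walk, found below #|V| since a shortest walk is a path;
   #|V| is only the value for vertices in different components. *)
Definition dist (x y : V) : nat :=
  find (fun k => has_walk k x y) (iota 0 #|V|).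

Definition metric_generator (S : {set V}) : bool :=
  [forall x, forall y, (x != y) ==> [exists s in S, dist s x != dist s y]].

Definition adjacency_generator (S : {set V}) : bool :=
  [forall x in ~: S, forall y in ~: S, (x != y) ==>
     [exists s in S, #|open_nbhd s :&: [set x; y]| == 1]].

(* The default [set: V] of the argmin is itself a generator, by
   [metric_generatorT] and [adjacency_generatorT]. *)
Definition dim : nat :=
  #|[arg min_(S < [set: V] | metric_generator S) #|S|]|.

Definition dim_A : nat :=
  #|[arg min_(S < [set: V] | adjacency_generator S) #|S|]|.

Lemma has_walkP k x y :
  reflect (exists p : seq V, [/\ size p = k, path e x p & last x p = y])
          (has_walk k x y).
Proof.
apply: (iffP existsP) => [[p /andP[pp /eqP lp]]|[p [sp pp lp]]].
  by exists p; rewrite size_tuple.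
by exists (Tuple (introT eqP sp)); rewrite /= pp lp eqxx.
Qed.

Lemma distP x y : connect e x y ->
  (exists p : seq V, [/\ size p = dist x y, path e x p & last x p = y]) /\
  (forall p : seq V, path e x p -> last x p = y -> dist x y <= size p).
Proof.
move=> /connectP[p0 p0p p0l]; rewrite /dist; pose w k := has_walk k x y; rewrite -/w.
have walk_lt : has w (iota 0 #|V|).
  case/shortenP: p0p p0l => q pq uq _ lq.
  apply/hasP; exists (size q); last by apply/has_walkP; exists q.
  by rewrite mem_iota /= add0n -[_ < _]/(size (x :: q) <= _)
             -(card_uniqP uq) max_card.
have lt_dV : find w (iota 0 #|V|) < #|V| by rewrite -{2}(size_iota 0 #|V|) -has_find.
split.
  by apply/has_walkP; have := nth_find 0 walk_lt; rewrite nth_iota.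
move=> p pp pl; rewrite leqNgt; apply/negP => lt_pd.
have := before_find 0 lt_pd; rewrite nth_iota ?(ltn_trans lt_pd) // add0n.
by case/has_walkP; exists p.
Qed.

Lemma dist_eq0 x y : (dist x y == 0) = (x == y).
Proof.
have V0 : 0 < #|V| by apply/card_gt0P; exists x.
rewrite /dist; case: #|V| V0 => //= n _.
have -> : has_walk 0 x y = (x == y).
  apply/has_walkP/eqP => [[p [sp _ <-]]|->]; last by exists [::].
  by rewrite (size0nil sp).
by case: (x == y).
Qed.

Lemma metric_generatorT : metric_generator [set: V].
Proof.
apply/forallP => x; apply/forallP => y; apply/implyP => neq_xy.
apply/existsP; exists x; rewrite inE /=.
have /eqP -> : dist x x == 0 by rewrite dist_eq0.
by rewrite eq_sym dist_eq0.
Qed.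

Lemma adjacency_generatorT : adjacency_generator [set: V].
Proof. by apply/forallP => x; rewrite !inE. Qed.

Lemma dimP :
  (exists2 S, metric_generator S & #|S| = dim) /\
  (forall S, metric_generator S -> dim <= #|S|).
Proof.
rewrite /dim; case: arg_minnP => [|S gS minS]; first exact: metric_generatorT.
by split; first exists S.
Qed.

Lemma dim_AP :
  (exists2 S, adjacency_generator S & #|S| = dim_A) /\
  (forall S, adjacency_generator S -> dim_A <= #|S|).
Proof.
rewrite /dim_A; case: arg_minnP => [|S gS minS]; first exact: adjacency_generatorT.
by split; first exists S.
Qed.

End Graphs.

(* Main.v *)
(** For distinct twins [x], [y], no third vertex separates them by adjacency,
hence none by distance, so a metric generator omits at most one vertex of each
class and [n - t <= dim].  An adjacency generator of a connected graph is a
metric generator, so [dim <= dim_A].  Finally the complement [S] of a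
transversal [X] of the classes is an adjacency generator: two distinct vertices
of [X] are not twins, so a third vertex [z] is adjacent to exactly one of them,
and as the class of [z] is not a singleton, [z] can be replaced by a twin
in [S]. *)

Require Import Defs.
From mathcomp Require Import all_boot.

Set Implicit Arguments.
Unset Strict Implicit.
Unset Printing Implicit Defensive.

Section TwinRelation.

Variables (V : finType) (e : rel V).
Hypotheses (e_sym : symmetric e) (e_irr : irreflexive e).

(** This form treats adjacent and non-adjacent twins alike. Conversely, agreement on third vertices
    makes the closed neighbourhoods equal if [x] and [y] are adjacent, and the open ones equal if
    they are not. *)
Lemma twinP x y :
  reflect (forall z, z != x -> z != y -> e z x = e z y) (twin e x y).
Proof.
apply: (iffP orP) => [[] /eqP/setP eq_xy z|eq_xy].
- move=> /negPf zx /negPf zy; have := eq_xy z.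
  by rewrite !inE zx zy !(e_sym _ z).
- by move=> _ _; have := eq_xy z; rewrite !inE !(e_sym _ z).
case exy: (e x y); [left | right]; apply/eqP/setP => z; rewrite !inE.
- have [->|zx] := eqVneq z x; first by rewrite e_sym exy orbT.
  have [->|zy] := eqVneq z y; first by rewrite exy.
  by rewrite /= !(e_sym _ z) eq_xy.
- have [->|zx] := eqVneq z x; first by rewrite e_irr e_sym exy.
  have [->|zy] := eqVneq z y; first by rewrite e_irr exy.
  by rewrite !(e_sym _ z) eq_xy.
Qed.

Lemma twin_refl : reflexive (twin e).
Proof. by move=> x; apply/twinP. Qed.

Lemma twin_sym : symmetric (twin e).
Proof. by move=> x y; rewrite /twin /= eq_sym [in X in _ || X]eq_sym. Qed.

Lemma twin_trans : transitive (twin e).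
Proof.
move=> y x z /twinP txy /twinP tyz.
have [->|xy] := eqVneq x y; first exact/twinP.
have [<-|yz] := eqVneq y z; first exact/twinP.
apply/twinP => w wx wz; have [->|wy] := eqVneq w y; last by rewrite txy ?tyz.
have [<-//|xz] := eqVneq x z.
(* Only [w = y] remains: [tyz] at the vertex [x] trades the pair [x y] for [x z], and [txy] at the
   vertex [z] trades that for [z y]. *)
by rewrite e_sym tyz // e_sym txy 1?eq_sym // e_sym.
Qed.

Lemma twin_equivalence :
  {in [set: V] & &, equivalence_rel (twin e)}.
Proof.
move=> x y z _ _ _; split=> [|txy]; first exact: twin_refl.
apply/idP/idP; last exact: twin_trans.
by apply: twin_trans; rewrite twin_sym.
Qed.

Lemma twin_classes_partition : partition (twin_classes e) [set: V].
Proof. exact: equivalence_partitionP twin_equivalence. Qed.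

Lemma pblock_twin x y :
  (pblock (twin_classes e) x == pblock (twin_classes e) y) = twin e x y.
Proof.
have /and3P[/eqP cov tI _] := twin_classes_partition.
rewrite eq_pblock ?cov ?inE //.
by rewrite pblock_equivalence_partition ?inE //; apply: twin_equivalence.
Qed.

Lemma card_nbhd_pair s x y : x != y ->
  (#|open_nbhd e s :&: [set x; y]| == 1) = (e s x != e s y).
Proof.
move=> xy; rewrite setIC setIUl cardsU.
have -> : [set x] :&: open_nbhd e s :&: ([set y] :&: open_nbhd e s) = set0.
  by apply/setP => z; rewrite !inE; have [->|] := eqVneq z x; rewrite // (negPf xy) andbF.
have card1 z : #|[set z] :&: open_nbhd e s| = e s z.
  case esz: (e s z).
    by rewrite (setIidPl _) ?cards1 // sub1set inE.
  by apply: eq_card0 => w; rewrite !inE; case: eqP => // ->.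
by rewrite cards0 subn0 !card1; do 2!case: (e s _).
Qed.

Hypothesis e_conn : connected_graph e.

Lemma dist_eq1 x y : (dist e x y == 1) = e x y.
Proof.
have [[p [sp pp lp]] dmin] := distP (e_conn x y).
apply/eqP/idP => [d1|exy].
  by move: sp pp lp; rewrite d1; case: p => [|a []] //= _ /andP[? _] <-.
apply/eqP; rewrite eqn_leq (dmin [:: y]) /= ?exy // lt0n dist_eq0.
by apply: contraTneq exy => ->; rewrite e_irr.
Qed.

(** A shortest walk from [s] to [y] has a last edge because [s != y]. If that edge starts at [x],
    drop it; otherwise its start is a third vertex, so the edge can be redirected to the twin
    [x]. *)
Lemma dist_twin_le s x y : twin e x y -> s != y -> dist e s x <= dist e s y.
Proof.
move=> /twinP txy sy; have [[p [<- pp lp]] _] := distP (e_conn s y).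
have [_ dmin] := distP (e_conn s x).
case: (lastP p) pp lp => [|q z] /=; first by move=> _ sE; rewrite sE eqxx in sy.
rewrite rcons_path last_rcons => /andP[pq eqz] zy; rewrite {z}zy in eqz *.
have [lx|lx] := eqVneq (last s q) x.
  by rewrite size_rcons (leq_trans (dmin q _ _)).
have ly : last s q != y by apply: contraTneq eqz => ->; rewrite e_irr.
by rewrite size_rcons -(size_rcons q x) dmin ?last_rcons // rcons_path pq txy.
Qed.

Lemma dist_twin s x y :
  twin e x y -> s != x -> s != y -> dist e s x = dist e s y.
Proof.
move=> txy sx sy; apply/eqP.
by rewrite eqn_leq !dist_twin_le // twin_sym.
Qed.

(** A vertex of [S] is the only one at distance 0 from itself; for pairs outside [S], adjacency to
    [s] means distance 1 from [s]. *)
Lemma adjacency_metric_generator S :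
  adjacency_generator e S -> metric_generator e S.
Proof.
move=> /forall_inP gS; apply/forallP => x; apply/forallP => y.
apply/implyP => xy.
have dxx z : dist e z z = 0 by apply/eqP; rewrite dist_eq0.
have [xS|xS] := boolP (x \in S).
  by apply/exists_inP; exists x; rewrite // dxx eq_sym dist_eq0.
have [yS|yS] := boolP (y \in S).
  by apply/exists_inP; exists y; rewrite // dxx dist_eq0 eq_sym.
have xC : x \in ~: S by rewrite inE.
have yC : y \in ~: S by rewrite inE.
have /exists_inP[s sS] := implyP (forall_inP (gS x xC) y yC) xy.
rewrite card_nbhd_pair // -!dist_eq1 => dxy.
by apply/exists_inP; exists s => //; apply: contraNneq dxy => ->.
Qed.

Lemma metric_generator_card S :
  metric_generator e S -> #|V| - #|twin_classes e| <= #|S|.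
Proof.
move=> /forallP gS; rewrite leq_subLR -(cardsC S) addnC leq_add2r.
have /and3P[/eqP cov _ _] := twin_classes_partition.
(* It suffices that the class map is injective on the complement of [S]. *)
rewrite -(@card_in_imset _ _ (pblock (twin_classes e))).
  apply/subset_leq_card/subsetP => _ /imsetP[x _ ->].
  by rewrite pblock_mem // cov inE.
move=> x y; rewrite !inE => xS yS /eqP; rewrite pblock_twin => txy.
apply: contraTeq isT => xy.
have /exists_inP[s sS /eqP[]] := implyP (forallP (gS x) y) xy.
by apply: dist_twin => //; [apply: contraNneq xS | apply: contraNneq yS] => <-.
Qed.

Lemma transversal_adjacency_generator X :
  (forall C, C \in twin_classes e -> #|C| <> 1) ->
  is_transversal X (twin_classes e) [set: V] ->
  adjacency_generator e (~: X).
Proof.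
move=> nosing trX; have /and3P[/eqP cov tI _] := twin_classes_partition.
have injX := pblock_inj trX.
have twinX x y : x \in X -> y \in X -> twin e x y -> x = y.
  by move=> xX yX; rewrite -pblock_twin => /eqP; apply: injX.
(* The class of [z] has a second element, and [X] meets that class only in [z]. *)
have twinS z : z \in X -> exists2 w, w \notin X & twin e z w.
  move=> zX; have zC : pblock (twin_classes e) z \in twin_classes e.
    by rewrite pblock_mem // cov inE.
  have zz : z \in pblock (twin_classes e) z by rewrite mem_pblock cov inE.
  have [C1|/set0Pn[w]] := eqVneq (pblock (twin_classes e) z :\ z) set0.
    by case: (nosing _ zC); rewrite (cardsD1 z) zz C1 cards0.
  rewrite !inE => /andP[wz].
  rewrite pblock_equivalence_partition ?inE // => [tzw|]; last exact: twin_equivalence.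
  by exists w => //; apply: contraNN wz => wX; rewrite (twinX z w).
apply/forall_inP => x; rewrite !inE negbK => xX.
apply/forall_inP => y; rewrite !inE negbK => yX; apply/implyP => xy.
have /forallPn[z] : ~~ [forall z, (z != x) ==> (z != y) ==> (e z x == e z y)].
  apply: contraNN xy => /forallP txy; apply/eqP/twinX => //.
  by apply/twinP => z zx zy; have := txy z; rewrite zx zy => /eqP.
rewrite !negb_imply => /and3P[zx zy ezxy].
apply/exists_inP; have [zX|zX] := boolP (z \in X); last first.
  by exists z; rewrite ?inE // card_nbhd_pair.
have [w wX /twinP tzw] := twinS z zX.
(* Both [x] and [y] differ from [z] and from its twin [w], so [w] separates them as [z] does. *)
have wx : x != w by apply: contraNneq wX => <-.
have wy : y != w by apply: contraNneq wX => <-.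
exists w; rewrite ?inE // card_nbhd_pair // !(e_sym w).
by rewrite -!tzw 1?(eq_sym _ z) // !(e_sym _ z).
Qed.

End TwinRelation.

Theorem theorem27 (V : finType) (e : rel V)
    (e_sym : symmetric e) (e_irr : irreflexive e)
    (e_conn : connected_graph e)
    (no_singleton : forall C : {set V}, C \in twin_classes e -> #|C| <> 1) :
  dim_A e = dim e /\ dim e = #|V| - #|twin_classes e|.
Proof.
have [[S gS cS] dimmin] := dimP e; have [[A gA cA] dimAmin] := dim_AP e.
have lower : #|V| - #|twin_classes e| <= dim e.
  by rewrite -cS; apply: metric_generator_card.
have middle : dim e <= dim_A e.
  by rewrite -cA; apply/dimmin/adjacency_metric_generator.
have upper : dim_A e <= #|V| - #|twin_classes e|.
  have trX := transversalP (twin_classes_partition e_sym e_irr).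
  (* The bound becomes the size of the complement of the transversal. *)
  rewrite -(card_transversal trX) -(cardsC (transversal (twin_classes e) setT)).
  rewrite addKn.
  exact/dimAmin/transversal_adjacency_generator.
have dimE : dim e = #|V| - #|twin_classes e|.
  by apply/eqP; rewrite eqn_leq lower (leq_trans middle).
by split=> //; apply/eqP; rewrite eqn_leq middle dimE upper.
Qed.
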